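(* Let $X$ be a nonempty set. Then, for every mapping $\Phi$ with the domain $X^{2}$, the following statements are equivalent: (i) There is a strongly rigid, Ptolemaic pseudometric $d$ such that $\Phi$ is combinatorially similar to $d$. (ii) There is a strongly rigid pseudometric $d$ such that $\Phi$ is combinatorially similar to $d$. (iii) $\Phi$ is symmetric, the inequality $|\Phi(X^{2})| \leqslant \mathfrak{c}$ holds, there is $a_0 \in \Phi(X^{2})$ such that $\Phi$ is $a_0$-coherent, and, for all $x, y, u, v \in X$, the condition $$\Phi(x, y) = \Phi(u, v) \neq a_0$$ implies $$(\Phi(x,u)=a_0 \text{ and } \Phi(y,v)=a_0) \text{ or } (\Phi(x,v)=a_0 \text{ and } \Phi(y,u)=a_0).$$
   Context: $\mathfrak{c}$ is the cardinality of the continuum. A mapping $\Phi$ with domain $X^2$ may take values in an arbitrary set; $\Phi(X^2)$ is its image. It is symmetric if $\Phi(x,y)=\Phi(y,x)$ for all $x,y\in X$. A pseudometric on a set $Y$ is a function $d\colon Y^2\to\mathbb{R}$ that is nonnegative, symmetric, satisfies $d(x,x)=0$ for all $x\in Y$, and satisfies the triangle inequality. It is Ptolemaic if $d(x,z)d(y,t)+d(x,t)d(y,z)\geqslant d(x,y)d(z,t)$ for all $x,y,z,t\in Y$. It is strongly rigid if, for all $x,y,u,v\in Y$, $d(x,y)=d(u,v)\neq 0$ implies that ($d(x,u)=0$ and $d(y,v)=0$) or ($d(x,v)=0$ and $d(y,u)=0$). A mapping $\Phi$ with domain $X^2$ is combinatorially similar to a mapping $\Psi$ with domain $Y^2$ if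 there are bijections $f\colon\Phi(X^2)\to\Psi(Y^2)$ and $g\colon Y\to X$ such that $\Psi(x,y)=f(\Phi(g(x),g(y)))$ for all $x,y\in Y$. In (i) and (ii), $d$ is a pseudometric on some set $Y$. For $a_0\in\Phi(X^2)$, $\Phi$ is $a_0$-coherent if $\Phi^{-1}(a_0)=\{\langle x,y\rangle\in X^2:\Phi(x,y)=a_0\}$ is an equivalence relation on $X$ and, for all $x_1,x_2,x_3,x_4\in X$, the conditions $\Phi(x_1,x_2)=a_0$ and $\Phi(x_3,x_4)=a_0$ imply $\Phi(x_1,x_3)=\Phi(x_2,x_4)$. *)

(* Defs.v *)
From Corelib Require Import RelationClasses.
From mathcomp Require Import all_boot all_order all_algebra.
From mathcomp Require Import boolp classical_sets functions cardinality reals.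

Set Implicit Arguments.
Unset Strict Implicit.
Unset Printing Implicit Defensive.

Import Order.TTheory GRing.Theory Num.Theory.

Local Open Scope classical_set_scope.
Local Open Scope ring_scope.

Definition symmetric_mapping (X T : Type) (Phi : X * X -> T) : Prop :=
  forall x y, Phi (x, y) = Phi (y, x).

Definition pseudometric (R : realType) (Y : Type) (d : Y * Y -> R) : Prop :=
  [/\ forall x y, 0 <= d (x, y),
      symmetric_mapping d,
      forall x, d (x, x) = 0 &
      forall x y z, d (x, z) <= d (x, y) + d (y, z)].

Definition ptolemaic (R : realType) (Y : Type) (d : Y * Y -> R) : Prop :=
  forall x y z t,
    d (x, z) * d (y, t) + d (x, t) * d (y, z) >= d (x, y) * d (z, t).

Definition strongly_rigid (R : realType) (Y : Type) (d : Y * Y -> R) : Prop :=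
  forall x y u v, d (x, y) = d (u, v) -> d (u, v) <> 0 ->
    (d (x, u) = 0 /\ d (y, v) = 0) \/ (d (x, v) = 0 /\ d (y, u) = 0).

(* As usual with [set_bij], [f] is a total function of which only the
   restriction to the image of [Phi] matters; for nonempty [X] such a total
   extension of a bijection between the images always exists. *)
Definition combinatorially_similar (X Y T U : Type)
    (Phi : X * X -> T) (Psi : Y * Y -> U) : Prop :=
  exists (f : T -> U) (g : Y -> X),
    [/\ set_bij (range Phi) (range Psi) f,
        bijective g &
        forall x y, Psi (x, y) = f (Phi (g x, g y))].

Definition coherent (X T : Type) (Phi : X * X -> T) (a0 : T) : Prop :=
  Equivalence (fun x y => Phi (x, y) = a0) /\
  forall x1 x2 x3 x4, Phi (x1, x2) = a0 -> Phi (x3, x4) = a0 ->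
    Phi (x1, x3) = Phi (x2, x4).

(* Main.v *)
(* A pseudometric whose nonzero values all lie in an interval [a, b] with
   b <= 2 a and b^2 <= 2 a^2 satisfies the triangle and the Ptolemaic
   inequalities for free, once points at distance 0 are interchangeable.  Since
   R embeds in such an interval, a mapping with at most continuum many values
   can be relabelled to satisfy both, sending a0 to 0; strong rigidity
   and coherence only depend on which values coincide and which value is 0. *)
Require Import Defs.
From mathcomp Require Import all_boot all_order all_algebra.
From mathcomp Require Import boolp classical_sets functions cardinality reals.
From mathcomp Require Import lra.

Import Order.TTheory GRing.Theory Num.Theory.

Local Open Scope classical_set_scope.
Local Open Scope card_scope.
Local Open Scope ring_scope.

(** The standard injection [r / (1 + |r|)] of the line into (-1, 1), rescaled to radius 1/10 around
    6/5. *)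
Definition squeeze {R : realFieldType} (r : R) : R :=
  6 / 5 + r / (1 + `|r|) / 10.

Lemma squeeze_bounds {R : realFieldType} (r : R) :
  11 / 10 <= squeeze r <= 13 / 10.
Proof.
have p : 0 < 1 + `|r| by rewrite ltr_pwDl.
have : `|r / (1 + `|r|)| <= 1.
  by rewrite normrM normfV (gtr0_norm p) ler_pdivrMr // mul1r lerDr.
rewrite ler_norml /squeeze => /andP[? ?]; apply/andP; split; lra.
Qed.

Lemma squeeze_inj {R : realFieldType} : injective (@squeeze R).
Proof.
move=> r s rs; have {}rs : r / (1 + `|r|) = s / (1 + `|s|).
  by move: rs; rewrite /squeeze; lra.
have pos (t : R) : 0 < 1 + `|t| by rewrite ltr_pwDl.
have nz (t : R) : 1 + `|t| != 0 by rewrite gt_eqF.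
(* The image of [t] determines the factor [(1 + |t|)^-1], so equal images have equal denominators,
   which cancel. *)
have inv (t : R) : 1 - `|t / (1 + `|t|)| = (1 + `|t|)^-1.
  rewrite normrM normfV (gtr0_norm (pos t)).
  by rewrite -{1}(divff (nz t)) -mulrBl addrK mul1r.
by have := rs; rewrite -(inv r) -(inv s) rs inv => /(mulIf (invr_neq0 (nz s))).
Qed.

Section RangeInInterval.
Context {R : realType} {X : Type} (d : X * X -> R).
Hypothesis d_sym : symmetric_mapping d.
Hypothesis d_coh : coherent d 0.
Hypothesis d_range : forall x y, d (x, y) = 0 \/ 11 / 10 <= d (x, y) <= 13 / 10.

Lemma coherent_substl {x y} z : d (x, y) = 0 -> d (x, z) = d (y, z).
Proof. by case: d_coh => -[refl _ _] coh xy; apply: coh. Qed.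

(** In the triangle inequality, a zero summand lets its two points be interchanged; two nonzero
    summands add up to at least 22/10, above the maximum 13/10. *)
Lemma pseudometric_of_range : pseudometric d.
Proof.
split=> // [x y|x|x y z]; last 1 first.
- have [xy0|xy] := d_range x y; first by rewrite xy0 add0r (coherent_substl _ xy0).
  have [yz0|yz] := d_range y z.
    by rewrite yz0 addr0 d_sym -(coherent_substl _ yz0) d_sym.
  case: (d_range x z) => [-> |]; move/andP: xy => [? ?]; move/andP: yz => [? ?].
    by lra.
  by move=> /andP[? ?]; lra.
- by case: (d_range x y) => [-> //|/andP[? ?]]; lra.
- by case: d_coh => -[refl _ _] _; apply: refl.
Qed.

(** A zero factor on the larger side identifies two points and turns the inequality into an
    equality. Otherwise that side is at least 242/100, against at most 169/100 for the other. *)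
Lemma ptolemaic_of_range : ptolemaic d.
Proof.
have [d_ge0 _ _ _] := pseudometric_of_range => x y z t.
have [xz0|/andP[? _]] := d_range x z.
  rewrite xz0 mul0r add0r (coherent_substl y xz0) (coherent_substl t xz0).
  by rewrite (d_sym y z) mulrC.
have [yt0|/andP[? _]] := d_range y t.
  rewrite yt0 mulr0 add0r (d_sym x y) (d_sym z t).
  by rewrite (coherent_substl x yt0) (coherent_substl z yt0) (d_sym x t).
have [xt0|/andP[? _]] := d_range x t.
  rewrite xt0 mul0r addr0 (coherent_substl y xt0) (coherent_substl z xt0).
  by rewrite (d_sym t y) (d_sym t z) mulrC.
have [yz0|/andP[? _]] := d_range y z.
  rewrite yz0 mulr0 addr0 (d_sym x y) (d_sym x z).
  by rewrite (coherent_substl x yz0) (coherent_substl t yz0).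
have le13 u v : d (u, v) <= 13 / 10.
  by case: (d_range u v) => [-> |/andP[]//]; lra.
have low (a b : R) : 11 / 10 <= a -> 11 / 10 <= b -> 121 / 100 <= a * b.
  by move=> *; nra.
have up : d (x, y) * d (z, t) <= 13 / 10 * (13 / 10) by apply: ler_pM.
have := low (d (x, z)) (d (y, t)); have := low (d (x, t)) (d (y, z)).
by lra.
Qed.

End RangeInInterval.

Lemma combinatorially_similar_pseudometric {R : realType} {X T : Type}
    {Phi : X * X -> T} (hX : inhabited X) {Y : Type} {d : Y * Y -> R} :
  pseudometric d -> strongly_rigid d -> combinatorially_similar Phi d ->
  [/\ symmetric_mapping Phi, range Phi #<= [set: R] &
      exists a0 : T,
        [/\ range Phi a0, coherent Phi a0 &
            forall x y u v : X,
              Phi (x, y) = Phi (u, v) -> Phi (u, v) <> a0 ->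
              (Phi (x, u) = a0 /\ Phi (y, v) = a0) \/
              (Phi (x, v) = a0 /\ Phi (y, u) = a0)]].
Proof.
move=> [d_ge0 d_sym d0 d_tri] rig [f [g [[_ f_inj _] [h gK hK] fE]]].
have rP p : Phi p \in range Phi by apply/mem_set; exists p.
(* Injectivity of [f] on the range makes [Phi] and [d], read through the inverse [h] of [g], have
   the same coincidences; everything below is transported along this. *)
have samePhi x y u v : Phi (x, y) = Phi (u, v) <-> d (h x, h y) = d (h u, h v).
  by rewrite !fE !hK; split=> [-> //|]; apply: f_inj.
have [x0] := hX; pose a0 := Phi (x0, x0).
have zP x y : Phi (x, y) = a0 <-> d (h x, h y) = 0 by rewrite samePhi d0.
(* Two triangle inequalities with a zero side bound each distance by the other. *)
have substl x y z : d (x, y) = 0 -> d (x, z) = d (y, z).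
  move=> xy0; apply/le_anti/andP; have := d_tri x y z; have := d_tri y x z.
  by rewrite (d_sym y x) xy0 !add0r => -> ->.
split.
- by move=> x y; apply/samePhi.
- have [fI] : $|{injfun range Phi >-> [set: R]}| by apply/injfunPex; exists f.
  exact: inj_card_le fI.
exists a0; split; first by exists (x0, x0).
- split.
    split=> [x|x y|x y z]; rewrite !zP; [by []|by rewrite d_sym|].
    by move=> xy0; rewrite (substl _ _ _ xy0).
  move=> x1 x2 x3 x4 /zP x12 /zP x34; apply/samePhi.
  by rewrite (substl _ _ _ x12) d_sym (substl _ _ _ x34) d_sym.
move=> x y u v /samePhi xyuv nz; rewrite !zP.
by apply: rig => // /zP.
Qed.

Lemma coherent_relabel {X T U : Type} {Phi : X * X -> T} {a0 : T} {f : T -> U} :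
  {in range Phi &, injective f} -> range Phi a0 -> coherent Phi a0 ->
  coherent (f \o Phi) (f a0).
Proof.
move=> f_inj a0r [[r s t] coh].
have zP p : f (Phi p) = f a0 <-> Phi p = a0.
  by split=> [|-> //]; apply: f_inj; apply/mem_set => //; exists p.
split; last by move=> x1 x2 x3 x4 /zP x12 /zP x34 /=; rewrite (coh _ _ _ _ x12 x34).
by split=> [x|x y|x y z]; rewrite /= !zP; [exact: r|exact: s|exact: t].
Qed.

Theorem proposition4p4 (R : realType) (X : Type) (hX : inhabited X)
    (T : Type) (Phi : X * X -> T) :
  [<-> (exists (Y : Type) (d : Y * Y -> R),
          [/\ pseudometric d, strongly_rigid d, ptolemaic d &
              combinatorially_similar Phi d]);
       (exists (Y : Type) (d : Y * Y -> R),
          [/\ pseudometric d, strongly_rigid d &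
              combinatorially_similar Phi d]);
       [/\ symmetric_mapping Phi,
           range Phi #<= [set: R] &
           exists a0 : T,
             [/\ range Phi a0,
                 coherent Phi a0 &
                 forall x y u v : X,
                   Phi (x, y) = Phi (u, v) -> Phi (u, v) <> a0 ->
                   (Phi (x, u) = a0 /\ Phi (y, v) = a0) \/
                   (Phi (x, v) = a0 /\ Phi (y, u) = a0)]]].
Proof.
split; first by move=> [Y [d [dm rig _ sim]]]; exists Y, d.
split.
  by move=> [Y [d [dm rig sim]]]; exact: combinatorially_similar_pseudometric sim.
move=> [sym /card_leP[i] [a0 [a0r coh rig]]].
(* The injection [i] is defined on the range of [Phi] only; [j] extends it by the default value
   0. *)
pose j : T -> R := valLR 0 i.
have j_inj : {in range Phi &, injective j} by apply: inj.
(* Overriding the value at [a0] keeps injectivity on the range, since 0 lies outside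
   [11/10, 13/10]. *)
pose f t : R := if `[< t = a0 >] then 0 else squeeze (j t).
have fa0 : f a0 = 0 by rewrite /f; case: asboolP.
have f_range t : f t = 0 \/ 11 / 10 <= f t <= 13 / 10.
  by rewrite /f; case: asboolP => _; [left|right; apply: squeeze_bounds].
have f0 t : f t = 0 -> t = a0.
  rewrite /f; case: asboolP => // _; have /andP[? _] := squeeze_bounds (j t).
  by move=> ?; exfalso; lra.
have f_inj : {in range Phi &, injective f}.
  move=> s t sr tr; have [-> |/asboolPn sa] := pselect (s = a0).
    by rewrite fa0 => /esym/f0.
  have [-> |/asboolPn ta] := pselect (t = a0); first by rewrite fa0 => /f0.
  by rewrite /f (negbTE sa) (negbTE ta) => /squeeze_inj; exact: j_inj.
pose d := f \o Phi.
have d_sym : symmetric_mapping d by move=> x y; rewrite /d /= sym.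
have d_coh : coherent d 0 by rewrite -fa0; exact: coherent_relabel.
have d_range x y : d (x, y) = 0 \/ 11 / 10 <= d (x, y) <= 13 / 10.
  exact: f_range.
have zP p : d p = 0 <-> Phi p = a0 by split=> [/f0|]; rewrite /d /= => ->.
(* The points stay the same and only values are relabelled, so [g] will be the identity. *)
exists X, d; split.
- exact: pseudometric_of_range.
- move=> x y u v xyuv; rewrite !zP; apply: rig.
  by apply: f_inj xyuv; apply/mem_set; [exists (x, y)|exists (u, v)].
- exact: ptolemaic_of_range.
- exists f, id; split=> //; last by exists id.
  by split=> // [_ [p _ <-]|_ [p _ <-]]; [exists p|exists (Phi p) => //; exists p].
Qed.
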